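(* Let $n\ge 0$ and let $\alpha\in\pi_{h+n}(SO(m))$, $\beta\in\pi_k(S^h)$ and $\gamma\in\pi_\ell(S^k)$ satisfy $\alpha\circ\Sigma^n\beta=0$ and $\beta\circ\gamma=0$. Then the Toda bracket $\{J(\alpha),\Sigma^{m+n}\beta,\Sigma^{m+n}\gamma\}_{m+n}$ is well-defined and $$J\{\alpha,\Sigma^n\beta,\Sigma^n\gamma\}_n\subset(-1)^m\{J(\alpha),\Sigma^{m+n}\beta,\Sigma^{m+n}\gamma\}_{m+n}.$$
   Context: Spaces and maps are pointed, maps are identified with homotopy classes, $\Sigma$ denotes suspension. $SO(m)$ is the $m$-th rotation group. The $J$-homomorphism $J:\pi_k(SO(m))\to\pi_{k+m}(S^m)$ is the composite $\pi_k(SO(m))\xrightarrow{\Sigma^m}\pi_{k+m}(\Sigma^mSO(m))\xrightarrow{(G_m)_*}\pi_{k+m}(S^m)$, where $G_m:\Sigma^mSO(m)\to S^m$ is the Hopf construction obtained from the action of $SO(m)$ on $S^{m-1}$ by rotations. Toda brackets. For $\alpha\in[\Sigma^nY,Z]$, $\beta\in[X,Y]$, $\gamma\in[W,X]$ with $\alpha\circ\Sigma^n\beta=0$ and $\beta\circ\gamma=0$, the bracket $\{\alpha,\Sigma^n\beta,\Sigma^n\gamma\}_n\subset[\Sigma^{n+1}W,Z]$ is the set of all $(-1)^n\bar\alpha\circ\Sigma^n\tilde\gamma$, where $C_\beta=Y\cup_\beta CX$, $\bar\alpha\in[\Sigma^nC_\beta,Z]$ is an extension of $\alpha$, and $\tilde\gamma\in[\Sigma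 W,C_\beta]$ is a coextension of $\gamma$. It is called well-defined when the two composites $\alpha\circ\Sigma^n\beta$ and $\beta\circ\gamma$ vanish. *)

(* Defs.v *)
From HB Require Import structures.
From mathcomp Require Import all_boot all_order all_algebra generic_quotient.
From mathcomp Require Import all_classical all_reals topology.
From mathcomp Require Import normedtype.

Set Implicit Arguments.
Unset Strict Implicit.
Unset Printing Implicit Defensive.

Import Order.TTheory GRing.Theory Num.Theory.
Import numFieldNormedType.Exports.
Local Open Scope classical_set_scope.
Local Open Scope ring_scope.
Local Open Scope quotient_scope.

Section glue.
Context {T : topologicalType} {U : eqType} (c : T -> U).

Let glue_rel' (a b : T) := c a == c b.
Local Lemma glue_refl : reflexive glue_rel'. Proof. by move=> a; exact: eqxx. Qed.
Local Lemma glue_sym : symmetric glue_rel'. Proof. by move=> a b; exact: eq_sym. Qed.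
Local Lemma glue_trans : transitive glue_rel'.
Proof. by move=> a b d /eqP ca /eqP cb; apply/eqP; rewrite ca. Qed.
Definition glue_rel := EquivRel _ glue_refl glue_sym glue_trans.

Definition glue := {eq_quot glue_rel}.
HB.instance Definition _ := Topological.copy glue (quotient_topology glue).
HB.instance Definition _ := Quotient.on glue.

Definition glue_pi : T -> glue := \pi_glue.

Lemma glue_piP a b : glue_pi a = glue_pi b <-> c a = c b.
Proof. by split=> [/eqmodP/eqP //|cab]; apply/eqmodP/eqP. Qed.

Lemma glue_pi_continuous : continuous glue_pi.
Proof. exact: pi_continuous. Qed.

Lemma glue_ind (P : glue -> Prop) : (forall a, P (glue_pi a)) -> forall x, P x.
Proof. by move=> h x; rewrite -[x]reprK; exact: h. Qed.

Definition glue_lift (Z : Type) (f : T -> Z) : glue -> Z := f \o repr.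

Lemma glue_liftE (Z : Type) (f : T -> Z) :
  (forall a b, c a = c b -> f a = f b) -> forall a, glue_lift f (glue_pi a) = f a.
Proof.
by move=> fc a; rewrite /glue_lift /=; apply: fc; apply/glue_piP; exact: reprK.
Qed.

Lemma glue_lift_continuous (Z : topologicalType) (f : T -> Z) :
  continuous f -> (forall a b, c a = c b -> f a = f b) -> continuous (glue_lift f).
Proof.
move=> cf fc; apply: repr_comp_continuous => // a b /eqP ab.
by apply/eqP; apply: fc; apply/glue_piP.
Qed.

Lemma glue_continuous (Z : topologicalType) (f : glue -> Z) :
  continuous (f \o glue_pi) -> continuous f.
Proof. by move=> cf; apply/quotient_continuous. Qed.

End glue.


Section unit_interval.
Context (R : realType).

Definition I01 : topologicalType := [set` `[0 : R, 1]] : set R.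

Definition i01 (t : I01) : R := set_val t.

Lemma i01_itv (t : I01) : 0 <= i01 t <= 1.
Proof. by case: t => x xP; move: (set_mem xP); rewrite /= in_itv. Qed.

Fact clamp_subproof (x : R) :
  Num.max 0 (Num.min x 1) \in ([set` `[0 : R, 1]] : set R).
Proof.
by apply/mem_set; rewrite /= in_itv /= le_max lexx /= ge_max ler01 /= ge_min lexx orbT.
Qed.

Definition clamp (x : R) : I01 :=
  @exist R (fun y => y \in ([set` `[0 : R, 1]] : set R)) _ (clamp_subproof x).

Lemma i01_inj : injective i01.
Proof. by move=> [x xP] [y yP] /= xy; apply: eq_sig_hprop. Qed.

Lemma clampE x : 0 <= x <= 1 -> i01 (clamp x) = x.
Proof. by move=> /andP[x0 x1]; rewrite /i01 set_valE /=; rewrite (min_l x1) (max_r x0). Qed.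

Lemma i01K t : clamp (i01 t) = t.
Proof. by apply: i01_inj; rewrite clampE// i01_itv. Qed.

Lemma i01_continuous : continuous i01.
Proof. exact: initial_continuous. Qed.

Lemma clamp_continuous : continuous clamp.
Proof.
apply: continuous_comp_initial => x.
have cmin : {for x, continuous ((id : R -> R^o) \min cst 1)}.
  by apply: continuous_min; [exact: cvg_id|exact: cvg_cst].
have c0 : {for x, continuous (cst 0 : R -> R^o)} by exact: cvg_cst.
by have := continuous_max c0 cmin; exact.
Qed.

Lemma I01_compact : compact [set: I01].
Proof.
rewrite (_ : [set: I01] = clamp @` [set` `[0 : R, 1]]).
  apply: continuous_compact; last exact: segment_compact.
  exact/continuous_subspaceT/clamp_continuous.
rewrite eqEsubset; split=> // t _; exists (i01 t); last exact: i01K.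
by rewrite /= in_itv/= i01_itv.
Qed.

Lemma I01_hausdorff : hausdorff_space I01.
Proof.
move=> p q pq; apply: i01_inj; apply: (@Rhausdorff R) => A B nA nB.
have [z [Az Bz]] := pq _ _ (i01_continuous nA) (i01_continuous nB).
by exists (i01 z).
Qed.

Lemma I01_locally_compact : locally_compact [set: I01].
Proof.
move=> x _; rewrite withinET; exists setT; first exact: filterT.
by split; [exact: I01_compact|exact: closedT].
Qed.

End unit_interval.
Arguments clamp {R} x.

Lemma continuous_if_le (R : realType) (T Z : topologicalType) (u : T -> R) (a : R)
    (f g : T -> Z) : continuous u -> continuous f -> continuous g ->
  (forall x, u x = a -> f x = g x) ->
  continuous (fun x => if u x <= a then f x else g x).
Proof.
move=> cu cf cg fg; apply/continuous_subspace_setT.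
rewrite (_ : setT = [set x | u x <= a] `|` [set x | a <= u x]); last first.
  rewrite eqEsubset; split=> // x _.
  by have [?|/ltW ?] := leP (u x) a; [left|right].
apply: withinU_continuous.
- exact: (closed_comp (fun x _ => cu x) (@closed_le R a)).
- exact: (closed_comp (fun x _ => cu x) (@closed_ge R a)).
- apply: (@subspace_eq_continuous _ _ _ f); last exact: continuous_subspaceT.
  by move=> x /set_mem xa; rewrite /from_subspace; move: xa => /= ->.
- apply: (@subspace_eq_continuous _ _ _ g); last exact: continuous_subspaceT.
  move=> x /set_mem ax; rewrite /from_subspace; move: ax => /= ax.
  by case: ifP => // xa; apply/esym/fg/eqP; rewrite eq_le xa ax.
Qed.

Lemma continuous_pair (T X Y : topologicalType) (f : T -> X) (g : T -> Y) :
  continuous f -> continuous g -> continuous (fun t => (f t, g t)).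
Proof. by move=> cf cg t; apply: cvg_pair; [exact: cf|exact: cg]. Qed.

Lemma continuous_fst (X Y : topologicalType) : continuous (@fst X Y).
Proof. by move=> ?; exact: cvg_fst. Qed.

Lemma continuous_snd (X Y : topologicalType) : continuous (@snd X Y).
Proof. by move=> ?; exact: cvg_snd. Qed.

Lemma continuous_compT (X Y Z : topologicalType) (f : X -> Y) (g : Y -> Z) :
  continuous f -> continuous g -> continuous (fun x => g (f x)).
Proof. by move=> cf cg x; apply: continuous_comp; [exact: cf|exact: cg]. Qed.

Record pmap (X Y : ptopologicalType) := Pmap {
  pmap_fun :> X -> Y;
  pmap_continuous : continuous pmap_fun;
  pmap_point : pmap_fun point = point }.

HB.instance Definition _ X Y := gen_eqMixin (pmap X Y).
HB.instance Definition _ X Y := gen_choiceMixin (pmap X Y).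

Lemma pmap_eqP X Y (f g : pmap X Y) : f =1 g -> f = g.
Proof.
case: f g => [f cf fp] [g cg gp] /= /funext fg; subst g.
by rewrite (Prop_irrelevance cf cg) (Prop_irrelevance fp gp).
Qed.

Definition pid X : pmap X X := @Pmap X X id (fun=> cvg_id) erefl.

Definition pconst X Y : pmap X Y :=
  @Pmap X Y (cst point) (fun=> cvg_cst _) erefl.

Lemma pcomp_continuous X Y Z (g : pmap Y Z) (f : pmap X Y) : continuous (g \o f).
Proof. by move=> x; apply: continuous_comp; exact: pmap_continuous. Qed.

Lemma pcomp_point X Y Z (g : pmap Y Z) (f : pmap X Y) : (g \o f) point = point.
Proof. by rewrite /= !pmap_point. Qed.

Definition pcomp X Y Z (g : pmap Y Z) (f : pmap X Y) : pmap X Z :=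
  Pmap (@pcomp_continuous _ _ _ g f) (pcomp_point g f).

Section homotopy.
Context (R : realType).
Implicit Types X Y Z : ptopologicalType.

Definition is_homotopy X Y (f g : pmap X Y) (F : X * I01 R -> Y) :=
  [/\ continuous F, forall x, F (x, clamp 0) = f x,
      forall x, F (x, clamp 1) = g x & forall t, F (point, t) = point].

Definition homotopic X Y (f g : pmap X Y) := exists F, is_homotopy f g F.

Lemma homotopic_refl X Y (f : pmap X Y) : homotopic f f.
Proof.
exists (f \o fst); split=> //= [|t]; last exact: pmap_point.
exact: (continuous_compT (@continuous_fst _ _) (@pmap_continuous _ _ f)).
Qed.

Lemma homotopic_sym X Y (f g : pmap X Y) : homotopic f g -> homotopic g f.
Proof.
move=> [F [cF F0 F1 Fp]].
exists (fun xt => F (xt.1, clamp (1 - i01 xt.2))); split=> [|x|x|t] //=.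
- apply: continuous_compT cF; apply: continuous_pair; first exact: continuous_fst.
  apply: continuous_compT (@clamp_continuous R) => xt.
  apply: cvgB; first exact: cvg_cst.
  exact: continuous_compT (@continuous_snd _ _) (@i01_continuous R) xt.
- by rewrite clampE ?lexx ?ler01// subr0.
- by rewrite clampE ?lexx ?ler01// subrr.
Qed.

Lemma homotopic_trans X Y (f g h : pmap X Y) :
  homotopic f g -> homotopic g h -> homotopic f h.
Proof.
move=> [F [cF F0 F1 Fp]] [G [cG G0 G1 Gp]].
exists (fun xt => if i01 xt.2 <= 2^-1 then F (xt.1, clamp (2 * i01 xt.2))
                  else G (xt.1, clamp (2 * i01 xt.2 - 1))).
have ci : continuous (fun xt : X * I01 R => i01 xt.2).
  exact: continuous_compT (@continuous_snd _ _) (@i01_continuous R).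
have c2i : continuous (fun xt : X * I01 R => 2 * i01 xt.2).
  by move=> xt; apply: cvgM; [exact: cvg_cst|exact: ci].
split=> [|x|x|t] //=.
- apply: continuous_if_le => //.
  + apply: continuous_compT cF; apply: continuous_pair; first exact: continuous_fst.
    exact: continuous_compT c2i (@clamp_continuous R).
  + apply: continuous_compT cG; apply: continuous_pair; first exact: continuous_fst.
    apply: continuous_compT (@clamp_continuous R) => xt.
    by apply: cvgB; [exact: c2i|exact: cvg_cst].
  + by move=> [x t] /= ->; rewrite mulfV ?pnatr_eq0// subrr F1 G0.
- by rewrite clampE ?lexx ?ler01// mulr0 invr_ge0 ler0n.
- rewrite clampE ?lexx ?ler01// mulr1 ifF.
    by rewrite (_ : 2 - 1 = 1) // -[2]/(1 + 1) addrK.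
  by apply/negbTE; rewrite -ltNge invf_lt1// ltr1n.
- by case: ifP; rewrite ?Fp ?Gp.
Qed.

Lemma homotopic_comp X Y Z (f f' : pmap X Y) (g g' : pmap Y Z) :
  homotopic g g' -> homotopic f f' -> homotopic (pcomp g f) (pcomp g' f').
Proof.
move=> [G [cG G0 G1 Gp]] [F [cF F0 F1 Fp]].
exists (fun xt => G (F xt, xt.2)); split=> [|x|x|t] //=.
- apply: continuous_compT cG; apply: continuous_pair => //; exact: continuous_snd.
- by rewrite F0 G0.
- by rewrite F1 G1.
- by rewrite Fp Gp.
Qed.

Section classes.
Context (X Y : ptopologicalType).
Let hrel (f g : pmap X Y) := `[< homotopic f g >].
Local Lemma hrel_refl : reflexive hrel.
Proof. by move=> f; apply/asboolP; exact: homotopic_refl. Qed.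
Local Lemma hrel_sym : symmetric hrel.
Proof. by move=> f g; apply: asbool_equiv_eq; split; exact: homotopic_sym. Qed.
Local Lemma hrel_trans : transitive hrel.
Proof.
by move=> g f h /asboolP fg /asboolP gh; apply/asboolP; exact: homotopic_trans gh.
Qed.
Definition homotopy_rel := EquivRel _ hrel_refl hrel_sym hrel_trans.

Definition hclass := {eq_quot homotopy_rel}.
HB.instance Definition _ := Quotient.on hclass.
HB.instance Definition _ := Choice.on hclass.

Definition hcls (f : pmap X Y) : hclass := \pi_hclass f.

Lemma hclsP f g : hcls f = hcls g <-> homotopic f g.
Proof. by split=> [/eqmodP/asboolP //|fg]; apply/eqmodP/asboolP. Qed.

Lemma hcls_repr a : hcls (repr a) = a.
Proof. exact: reprK. Qed.

Definition hzero : hclass := hcls (pconst X Y).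
End classes.

Definition hcomp X Y Z (b : hclass Y Z) (a : hclass X Y) : hclass X Z :=
  hcls (pcomp (repr b) (repr a)).

Lemma hcompE X Y Z (g : pmap Y Z) (f : pmap X Y) :
  hcomp (hcls g) (hcls f) = hcls (pcomp g f).
Proof. by apply/hclsP/homotopic_comp; apply/hclsP; rewrite hcls_repr. Qed.

Definition hcast X X' Y (E : X = X') (a : hclass X Y) : hclass X' Y :=
  eq_rect X (fun W => hclass W Y) a X' E.

End homotopy.

Section suspension.
Context (R : realType).
Implicit Types X Y Z : ptopologicalType.

Section space.
Context (X : ptopologicalType).

Definition susp_code (p : X * I01 R) : option (X * I01 R) :=
  if [|| p.1 == point, i01 p.2 == 0 | i01 p.2 == 1] then None else Some p.

Definition susp := glue susp_code.

HB.instance Definition _ := Topological.on susp.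
HB.instance Definition _ := Quotient.on susp.
HB.instance Definition _ :=
  isPointed.Build susp (glue_pi susp_code (point, clamp 0)).

Definition susp_pi (x : X) (t : I01 R) : susp := glue_pi susp_code (x, t).

Lemma susp_ind (P : susp -> Prop) :
  (forall x t, P (susp_pi x t)) -> forall z, P z.
Proof. by move=> h; apply: glue_ind => -[x t]; exact: h. Qed.

Lemma susp_pi_point x t :
  [|| x == point, i01 t == 0 | i01 t == 1] -> susp_pi x t = point.
Proof.
by move=> xt; apply/glue_piP; rewrite /susp_code /= xt eqxx.
Qed.

Lemma susp_codeP Z (f : X * I01 R -> Z) :
  (forall x t, [|| x == point, i01 t == 0 | i01 t == 1] -> f (x, t) = point) ->
  forall p q, susp_code p = susp_code q -> f p = f q.
Proof.
move=> f0 [x t] [y u]; rewrite /susp_code /=.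
case: ifPn => xt; case: ifPn => yu //; first by rewrite !f0.
by case=> -> ->.
Qed.

End space.

Section lift.
Context X Z (f : X * I01 R -> Z) (cf : continuous f).
Context (f0 : forall x t,
  [|| x == point, i01 t == 0 | i01 t == 1] -> f (x, t) = point).

Definition susp_lift_fun : susp X -> Z := glue_lift f.

Lemma susp_lift_continuous : continuous susp_lift_fun.
Proof. exact: glue_lift_continuous cf (susp_codeP f0). Qed.

Lemma susp_liftE x t : susp_lift_fun (susp_pi x t) = f (x, t).
Proof. by rewrite /susp_lift_fun glue_liftE //; exact: susp_codeP f0. Qed.

Lemma susp_lift_point : susp_lift_fun point = point.
Proof. by rewrite -(@susp_pi_point X point (clamp 0)) ?eqxx// susp_liftE f0 ?eqxx. Qed.

Definition susp_lift : pmap (susp X) Z := Pmap susp_lift_continuous susp_lift_point.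
End lift.

End suspension.

Section suspension_functor.
Context (R : realType).
Implicit Types X Y Z : ptopologicalType.

Lemma susp_pi_continuous X (T : topologicalType) (f : T -> X) (u : T -> I01 R) :
  continuous f -> continuous u -> continuous (fun a => susp_pi (f a) (u a)).
Proof.
move=> cf cu; apply: (@continuous_compT _ _ _ (fun a => (f a, u a))).
  exact: continuous_pair.
exact: glue_pi_continuous.
Qed.

Section map.
Context X Y (f : pmap X Y).
Let g (p : X * I01 R) : susp R Y := susp_pi (f p.1) p.2.

Local Lemma g_continuous : continuous g.
Proof.
apply: susp_pi_continuous; last exact: continuous_snd.
exact: (continuous_compT (@continuous_fst _ _) (@pmap_continuous _ _ f)).
Qed.

Local Lemma g_point x t :
  [|| x == point, i01 t == 0 | i01 t == 1] -> g (x, t) = point.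
Proof.
move=> xt; apply: susp_pi_point => /=; case/orP: xt => [/eqP ->|->].
  by rewrite pmap_point eqxx.
by rewrite orbT.
Qed.

Definition susp_map : pmap (susp R X) (susp R Y) := susp_lift g_continuous g_point.

Lemma susp_mapE x t : susp_map (susp_pi x t) = susp_pi (f x) t.
Proof. exact: susp_liftE g_point x t. Qed.

End map.

Section homotopy_lift.
Import ArrowAsCompactOpen.
Context X Z (F : X * I01 R -> I01 R -> Z).

Lemma susp_lift_homotopy : continuous (uncurry F) ->
  (forall x t s, [|| x == point, i01 t == 0 | i01 t == 1] -> F (x, t) s = point) ->
  continuous (fun xs : susp R X * I01 R => glue_lift (c:=@susp_code R X) F xs.1 xs.2).
Proof.
move=> cF F0.
have FE p q : susp_code p = susp_code q -> F p = F q.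
  move=> pq; apply/funext => s.
  by apply: (susp_codeP (f := F^~ s)) pq => x t; exact: F0.
have [cc cs] := continuous_curry cF.
rewrite (_ : (fun xs => _) = uncurry (glue_lift (c:=@susp_code R X) F)); last first.
  by apply/funext => -[].
apply: continuous_uncurry.
- exact: I01_locally_compact.
- exact: I01_hausdorff.
- exact: (glue_lift_continuous (f := F : _ -> {compact-open, I01 R -> Z})) FE.
- by apply: susp_ind => x t; rewrite glue_liftE //; exact: cs.
Qed.
End homotopy_lift.

Lemma homotopic_susp X Y (f g : pmap X Y) :
  homotopic R f g -> homotopic R (susp_map f) (susp_map g).
Proof.
move=> [F [cF F0 F1 Fp]].
pose K (p : X * I01 R) (s : I01 R) : susp R Y := susp_pi (F (p.1, s)) p.2.
have K0 x t s : [|| x == point, i01 t == 0 | i01 t == 1] -> K (x, t) s = point.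
  by move=> xt; apply: susp_pi_point => /=; case/orP: xt => [/eqP ->|->];
    rewrite ?Fp ?eqxx ?orbT.
have KE p q : susp_code p = susp_code q -> K p = K q.
  move=> pq; apply/funext => s.
  by apply: (susp_codeP (f := K^~ s)) pq => x t; exact: K0.
have cK : continuous (uncurry K).
  rewrite (_ : uncurry K = fun ps => susp_pi (F (ps.1.1, ps.2)) ps.1.2); last first.
    by apply/funext => -[].
  apply: susp_pi_continuous.
    apply: (continuous_compT _ cF); apply: continuous_pair; last exact: continuous_snd.
    exact: (continuous_compT (@continuous_fst _ _) (@continuous_fst _ _)).
  exact: (continuous_compT (@continuous_fst _ _) (@continuous_snd _ _)).
exists (fun xs => glue_lift (c:=@susp_code R X) K xs.1 xs.2); split.
- exact: susp_lift_homotopy.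
- apply: susp_ind => x t; rewrite susp_mapE /= glue_liftE //.
  by rewrite /K F0.
- apply: susp_ind => x t; rewrite susp_mapE /= glue_liftE //.
  by rewrite /K F1.
- move=> t; rewrite -(@susp_pi_point R X point (clamp 0)) ?eqxx//.
  by rewrite /= glue_liftE// K0 ?eqxx.
Qed.

Lemma susp_map_id X : susp_map (pid X) = pid (susp R X).
Proof. by apply: pmap_eqP; apply: susp_ind => x t; rewrite susp_mapE. Qed.

Lemma susp_map_comp X Y Z (g : pmap Y Z) (f : pmap X Y) :
  susp_map (pcomp g f) = pcomp (susp_map g) (susp_map f).
Proof.
apply: pmap_eqP; apply: susp_ind => x t; rewrite susp_mapE.
by rewrite [RHS](_ : _ = susp_map g (susp_map f (susp_pi x t))) // !susp_mapE.
Qed.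

Definition isusp (n : nat) (X : ptopologicalType) : ptopologicalType :=
  iter n (fun Y => susp R Y : ptopologicalType) X.

Fixpoint isusp_map (n : nat) X Y (f : pmap X Y) : pmap (isusp n X) (isusp n Y) :=
  if n is n'.+1 then susp_map (isusp_map n' f) else f.

Lemma homotopic_isusp n X Y (f g : pmap X Y) :
  homotopic R f g -> homotopic R (isusp_map n f) (isusp_map n g).
Proof. by move=> fg; elim: n => //= n IH; exact: homotopic_susp. Qed.

Definition hsusp n X Y (a : hclass R X Y) : hclass R (isusp n X) (isusp n Y) :=
  hcls R (isusp_map n (repr a)).

Lemma hsuspE n X Y (f : pmap X Y) : hsusp n (hcls R f) = hcls R (isusp_map n f).
Proof. by apply/hclsP/homotopic_isusp/hclsP; rewrite hcls_repr. Qed.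

Lemma isuspS n X : isusp n.+1 X = isusp n (susp R X).
Proof. exact: iterSr. Qed.

Lemma isuspD m n X : isusp (m + n) X = isusp m (isusp n X).
Proof. exact: iterD. Qed.

Section reversal.
Context (X : ptopologicalType).
Let r (p : X * I01 R) : susp R X := susp_pi p.1 (clamp (1 - i01 p.2)).

Local Lemma r_continuous : continuous r.
Proof.
apply: susp_pi_continuous; first exact: continuous_fst.
apply: (continuous_compT _ (@clamp_continuous R)) => p.
apply: cvgB; first exact: cvg_cst.
exact: (continuous_compT (@continuous_snd _ _) (@i01_continuous R)).
Qed.

Local Lemma r_point x t :
  [|| x == point, i01 t == 0 | i01 t == 1] -> r (x, t) = point.
Proof.
move=> xt; apply: susp_pi_point => /=; case/or3P: xt => [->//|/eqP ->|/eqP ->].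
  by rewrite subr0 clampE ?ler01 ?lexx// eqxx !orbT.
by rewrite subrr clampE ?ler01 ?lexx// eqxx !orbT.
Qed.

Definition susp_rev : pmap (susp R X) (susp R X) := susp_lift r_continuous r_point.

Lemma susp_revE x t : susp_rev (susp_pi x t) = susp_pi x (clamp (1 - i01 t)).
Proof. exact: susp_liftE r_point x t. Qed.
End reversal.

Definition hneg n X Y (a : hclass R (isusp n.+1 X) Y) : hclass R (isusp n.+1 X) Y :=
  hcomp a (hcls R (susp_rev (isusp n X))).

Definition hsign (k : nat) n X Y (a : hclass R (isusp n.+1 X) Y) :
  hclass R (isusp n.+1 X) Y := iter k (@hneg n X Y) a.

End suspension_functor.

Section toda_bracket.
Context (R : realType).
Implicit Types W X Y Z : ptopologicalType.

Section mapping_cone.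
Context X Y (b : pmap X Y).

Definition mcone_part (i : bool) : topologicalType :=
  if i then (Y : topologicalType) else (X * I01 R)%type.

Definition cyl_code (p : X * I01 R) : Y + X * I01 R :=
  if (p.1 == point) || (i01 p.2 == 1) then inl point
  else if i01 p.2 == 0 then inl (b p.1) else inr p.

(* The base of the cone is at t = 0, where it is glued to Y along b, and its    *)
(* vertex is at t = 1; the vertex and the line over the base point of X are     *)
(* identified with the base point of Y.                                         *)
Definition mcone_code (z : {i & mcone_part i}) : Y + X * I01 R :=
  match z with
  | existT true y => inl y
  | existT false p => cyl_code p
  end.

Definition mcone := glue mcone_code.

HB.instance Definition _ := Topological.on mcone.
HB.instance Definition _ := Quotient.on mcone.
HB.instance Definition _ := isPointed.Build mcone
  (glue_pi mcone_code (existT mcone_part true (point : Y))).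

Definition mcone_in_fun (y : Y) : mcone :=
  glue_pi mcone_code (existT mcone_part true y).

Definition mcone_cyl (x : X) (t : I01 R) : mcone :=
  glue_pi mcone_code (existT mcone_part false (x, t)).

Lemma mcone_in_continuous : continuous mcone_in_fun.
Proof.
exact: (continuous_compT (@existT_continuous _ mcone_part true)
                         (@glue_pi_continuous _ _ mcone_code)).
Qed.

Definition mcone_in : pmap Y mcone := Pmap mcone_in_continuous erefl.

Lemma mcone_cyl_continuous (T : topologicalType) (f : T -> X) (u : T -> I01 R) :
  continuous f -> continuous u -> continuous (fun a => mcone_cyl (f a) (u a)).
Proof.
move=> cf cu; apply: (@continuous_compT _ _ _ (fun a => (f a, u a))
  (fun p => mcone_cyl p.1 p.2)); first exact: continuous_pair.
rewrite (_ : (fun p => _) = fun p => glue_pi mcone_code (existT mcone_part false p));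
  last by apply/funext => -[].
exact: (continuous_compT (@existT_continuous _ mcone_part false)
                         (@glue_pi_continuous _ _ mcone_code)).
Qed.

Lemma mcone_cyl0 x : mcone_cyl x (clamp 0) = mcone_in (b x).
Proof.
apply/glue_piP; rewrite /= /cyl_code /= clampE ?ler01 ?lexx// eqxx [0 == 1]eq_sym oner_eq0 orbF.
by case: eqVneq => // ->; rewrite pmap_point.
Qed.

Lemma mcone_cyl1 x t : (x == point) || (i01 t == 1) -> mcone_cyl x t = point.
Proof. by move=> xt; apply/glue_piP; rewrite /= /cyl_code /= xt. Qed.

End mapping_cone.

Section coextension.
Context W X Y (b : pmap X Y) (g : pmap W X) (A : W * I01 R -> Y).
Context (hA : is_homotopy (pcomp b g) (pconst W Y) A).

Definition coext_fun (p : W * I01 R) : mcone b :=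
  if i01 p.2 <= 2^-1 then mcone_cyl b (g p.1) (clamp (1 - 2 * i01 p.2))
  else mcone_in b (A (p.1, clamp (2 * i01 p.2 - 1))).

Lemma coext_continuous : continuous coext_fun.
Proof.
have [cA A0 _ _] := hA.
have ci : continuous (fun xt : W * I01 R => i01 xt.2).
  exact: (continuous_compT (@continuous_snd _ _) (@i01_continuous R)).
have c2i : continuous (fun xt : W * I01 R => 2 * i01 xt.2).
  by move=> xt; apply: cvgM; [exact: cvg_cst|exact: ci].
apply: continuous_if_le => //.
- apply: mcone_cyl_continuous.
    exact: (continuous_compT (@continuous_fst _ _) (@pmap_continuous _ _ g)).
  apply: (continuous_compT _ (@clamp_continuous R)) => p.
  by apply: cvgB; [exact: cvg_cst|exact: c2i].
- apply: (continuous_compT _ (@mcone_in_continuous _ _ b)).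
  apply: (continuous_compT _ cA); apply: continuous_pair; first exact: continuous_fst.
  apply: (continuous_compT _ (@clamp_continuous R)) => p.
  by apply: cvgB; [exact: c2i|exact: cvg_cst].
- by move=> [w t] /= ->; rewrite mulfV ?pnatr_eq0// subrr mcone_cyl0 A0.
Qed.

Lemma coext_point w t :
  [|| w == point, i01 t == 0 | i01 t == 1] -> coext_fun (w, t) = point.
Proof.
have [_ _ A1 Ap] := hA.
rewrite /coext_fun /=; case/or3P => /eqP wt.
- case: ifP => _; last by rewrite wt Ap.
  by apply: mcone_cyl1; rewrite wt pmap_point eqxx.
- rewrite wt invr_ge0 ler0n mulr0 subr0; apply: mcone_cyl1.
  by rewrite clampE ?ler01 ?lexx// eqxx orbT.
- rewrite wt ifF; last by apply/negbTE; rewrite -ltNge invf_lt1// ltr1n.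
  by rewrite mulr1 (_ : 2 - 1 = 1) ?A1// -[2]/(1 + 1) addrK.
Qed.

Definition coext : pmap (susp R W) (mcone b) := susp_lift coext_continuous coext_point.

End coextension.

Definition is_coextension W X Y (b : pmap X Y) (gamma : hclass R W X)
    (c : hclass R (susp R W) (mcone b)) : Prop :=
  exists (g : pmap W X) (A : W * I01 R -> Y)
         (hA : is_homotopy (pcomp b g) (pconst W Y) A),
    hcls R g = gamma /\ c = hcls R (coext hA).

Definition is_extension n X Y Z (b : pmap X Y) (alpha : hclass R (isusp R n Y) Z)
    (a : hclass R (isusp R n (mcone b)) Z) : Prop :=
  hcomp a (hsusp n (hcls R (mcone_in b))) = alpha.

Definition toda_defined n W X Y Z (alpha : hclass R (isusp R n Y) Z)
    (beta : hclass R X Y) (gamma : hclass R W X) : Prop :=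
  hcomp alpha (hsusp n beta) = hzero R _ _ /\ hcomp beta gamma = hzero R _ _.

Definition toda n W X Y Z (alpha : hclass R (isusp R n Y) Z)
    (beta : hclass R X Y) (gamma : hclass R W X) :
    set (hclass R (isusp R n.+1 W) Z) :=
  [set theta | exists (b : pmap X Y) (a : hclass R (isusp R n (mcone b)) Z)
                      (c : hclass R (susp R W) (mcone b)),
     [/\ hcls R b = beta, is_extension alpha a, is_coextension gamma c &
         theta = hsign n (hcast (esym (isuspS R n W)) (hcomp a (hsusp n c)))]].

End toda_bracket.

Lemma continuous_mx (R : realType) (T : topologicalType) (m n : nat)
    (f : T -> 'M[R]_(m, n)) :
  (forall i j, continuous (fun t => f t i j)) -> continuous f.
Proof.
move=> cf t U [P nP PU]; apply: (filterS (P := [set s | forall i j, P i j (f s i j)])).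
  by move=> s Ps; apply: PU.
apply: filter_forall => i; apply: filter_forall => j.
exact: cf (nP i j).
Qed.

Section J_homomorphism.
Context (R : realType).

Definition sphere (k : nat) : ptopologicalType := isusp R k bool.

Definition pi_ (k : nat) (X : ptopologicalType) := hclass R (sphere k) X.

Lemma sphereD k n : sphere (k + n) = isusp R n (sphere k).
Proof. by rewrite addnC; exact: isuspD. Qed.

Definition rotations (m : nat) : set 'M[R]_m :=
  [set A | A *m A^T = 1%:M /\ \det A = 1].

Lemma rotations1 m : 1%:M \in @rotations m.
Proof. by apply/mem_set; rewrite /rotations /= trmx1 mulmx1 det1. Qed.

Definition SO (m : nat) := set_type (@rotations m).

HB.instance Definition _ m := Topological.on (SO m).
HB.instance Definition _ m := isPointed.Build (SO m)
  (@exist _ (fun A => A \in @rotations m) _ (@rotations1 m)).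

Definition unit_vectors (m : nat) : set 'cV[R]_m :=
  [set y | \sum_i y i 0 ^+ 2 = 1].

Lemma unit_vectors_e0 m : delta_mx 0 0 \in @unit_vectors m.+1.
Proof.
apply/mem_set; rewrite /unit_vectors /= (bigD1 0) //= big1 => [|i i0].
  by rewrite mxE !eqxx expr1n addr0.
by rewrite mxE (negbTE i0) expr0n.
Qed.

Definition usphere (m : nat) := set_type (@unit_vectors m).

HB.instance Definition _ m := Topological.on (usphere m).
HB.instance Definition _ m := isPointed.Build (usphere m.+1)
  (@exist _ (fun y => y \in @unit_vectors m.+1) _ (@unit_vectors_e0 m)).

Lemma rotate_unit m (A : 'M[R]_m) (y : 'cV[R]_m) :
  rotations A -> unit_vectors y -> unit_vectors (A *m y).
Proof.
have sqE (z : 'cV[R]_m) : \sum_i z i 0 ^+ 2 = (z^T *m z) 0 0.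
  by rewrite mxE; apply: eq_bigr => i _; rewrite mxE expr2.
rewrite /rotations /unit_vectors /= => -[/mulmx1C AA _]; rewrite !sqE => yy.
by rewrite trmx_mul mulmxA -(mulmxA _ A^T) AA mulmx1.
Qed.

Lemma unit_neq0 m (y : 'cV[R]_m) : unit_vectors y -> `|y| != 0.
Proof.
rewrite /unit_vectors normr_eq0 /= => y1; apply/eqP => y0; move/eqP: y1.
by rewrite y0 big1 ?(eq_sym 0) ?oner_eq0// => i _; rewrite mxE expr0n.
Qed.

Section join.
Context (X Y : ptopologicalType).

Definition join_code (p : X * Y * I01 R) : option X * option Y * I01 R :=
  (if i01 p.2 == 1 then None else Some p.1.1,
   if i01 p.2 == 0 then None else Some p.1.2, p.2).

Definition join := glue join_code.

HB.instance Definition _ := Topological.on join.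
HB.instance Definition _ := Quotient.on join.
HB.instance Definition _ :=
  isPointed.Build join (glue_pi join_code (point, point, clamp 1)).

Definition join_pi (x : X) (y : Y) (t : I01 R) : join := glue_pi join_code (x, y, t).

Section lift.
Context (Z : ptopologicalType) (f : X -> Y -> I01 R -> Z).
Context (cf : continuous (fun p => f p.1.1 p.1.2 p.2)).
Context (f0 : forall x y y', f x y (clamp 0) = f x y' (clamp 0)).
Context (f1 : forall x y, f x y (clamp 1) = point).

Let g (p : X * Y * I01 R) : Z := f p.1.1 p.1.2 p.2.

Local Lemma join_codeP p q : join_code p = join_code q -> g p = g q.
Proof.
move: p q => [[x y] t] [[x' y'] t']; rewrite /join_code /g /=.
have [t1|t1] := eqVneq (i01 t) 1; have [t1'|t1'] := eqVneq (i01 t') 1 => //.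
  by move=> _; rewrite -(i01K t) -(i01K t') t1 t1' !f1.
have [t0|t0] := eqVneq (i01 t) 0; have [t0'|t0'] := eqVneq (i01 t') 0 => //.
  by case=> [-> _]; rewrite -(i01K t) -(i01K t') t0 t0' (f0 _ _ y').
by case=> [-> -> ->].
Qed.

Definition join_lift_fun : join -> Z := glue_lift g.

Lemma join_lift_continuous : continuous join_lift_fun.
Proof. exact: glue_lift_continuous cf join_codeP. Qed.

Lemma join_liftE x y t : join_lift_fun (join_pi x y t) = f x y t.
Proof. by rewrite /join_lift_fun glue_liftE //; exact: join_codeP. Qed.

Lemma join_lift_point : join_lift_fun point = point.
Proof. by rewrite join_liftE f1. Qed.

Definition join_lift : pmap join Z := Pmap join_lift_continuous join_lift_point.
End lift.
End join.

Section polar_coordinates.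
Context (X : ptopologicalType).

Fixpoint isusp_pi (n : nat) (x : X) (c : nat -> I01 R) : isusp R n X :=
  if n is n'.+1 then susp_pi (isusp_pi n' x c) (c n') else x.

Lemma isusp_pi_continuous n (T : topologicalType) (x : T -> X)
    (c : T -> nat -> I01 R) :
  continuous x -> (forall i, continuous (c^~ i)) ->
  continuous (fun a => isusp_pi n (x a) (c a)).
Proof. by move=> cx cc; elim: n => //= n IH; exact: susp_pi_continuous. Qed.

Lemma isusp_pi_point n x c :
  x = point \/ (exists2 i, (i < n)%N & (i01 (c i) == 0) || (i01 (c i) == 1)) ->
  isusp_pi n x c = point.
Proof.
elim: n => [[//|[]//]|n IH] h /=; apply: susp_pi_point.
case: h => [xp|[i]]; first by rewrite IH ?eqxx//; left.
rewrite ltnS leq_eqVlt => /predU1P[->|iln] ci; first by rewrite ci orbT.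
by rewrite IH ?eqxx//; right; exists i.
Qed.

Definition cube_coord (m : nat) (y : 'cV[R]_m.+1) (t : R) (i : nat) : I01 R :=
  clamp ((1 + t * (y (inord i) 0 / `|y|)) / 2).

Definition polar (m : nat) (x : X) (y : 'cV[R]_m.+1) (t : R) : isusp R m.+1 X :=
  isusp_pi m.+1 x (cube_coord y t).

Lemma polar_continuous m (T : topologicalType) (x : T -> X) (y : T -> 'cV[R]_m.+1)
    (t : T -> I01 R) :
  continuous x -> continuous y -> (forall a, `|y a| != 0) -> continuous t ->
  continuous (fun a => polar (x a) (y a) (i01 (t a))).
Proof.
move=> cx cy y0 ct; apply: isusp_pi_continuous => // i.
apply: (continuous_compT _ (@clamp_continuous R)) => a.
apply: cvgM; last exact: cvg_cst.
apply: cvgD; first exact: cvg_cst.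
apply: cvgM; first exact: (continuous_compT ct (@i01_continuous R)).
apply: cvgM.
  exact: (continuous_compT cy (@coord_continuous R _ _ (inord i) 0)).
apply: cvgV => //; exact: (continuous_compT cy (@norm_continuous _ _)).
Qed.

Lemma polar0 m x (y y' : 'cV[R]_m.+1) : polar x y 0 = polar x y' 0.
Proof.
rewrite /polar; congr isusp_pi; apply/funext => i.
by rewrite /cube_coord !mul0r.
Qed.

Lemma polar1 m x (y : 'cV[R]_m.+1) : `|y| != 0 -> polar x y 1 = point.
Proof.
move=> y0; have [[i j] /= yi] := mx_norm_neq0 y0.
apply: (@isusp_pi_point m.+1); right; exists i => //.
rewrite /cube_coord inord_val mul1r.
have -> : y i 0 / `|y| = Num.sg (y i 0).
  rewrite [X in _ / X](_ : _ = `|y i 0|); last first.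
    by rewrite /Num.norm /= yi (ord1 j).
  rewrite {1}[y i 0]numEsg mulfK//.
  by move: y0; rewrite /Num.norm /= yi (ord1 j).
have : y i 0 != 0 by rewrite -normr_eq0; move: y0; rewrite /Num.norm /= yi (ord1 j).
case: sgrP => // _ _; last by rewrite subrr mul0r clampE ?lexx ?ler01// eqxx.
by rewrite -[1 + 1]/2 mulfV ?pnatr_eq0// clampE ?lexx ?ler01// eqxx orbT.
Qed.

End polar_coordinates.

Section hopf_construction.
Context (m : nat).

Let value (A : SO m.+1) : 'M[R]_m.+1 := set_val A.
Let vector (y : usphere m.+1) : 'cV[R]_m.+1 := set_val y.

Local Lemma value_continuous : continuous value.
Proof. exact: initial_continuous. Qed.

Local Lemma vector_continuous : continuous vector.
Proof. exact: initial_continuous. Qed.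

Local Lemma value_rotations A : rotations (value A).
Proof. exact: set_valP. Qed.

Local Lemma vector_unit y : unit_vectors (vector y).
Proof. exact: set_valP. Qed.

Let proj (A : SO m.+1) (y : usphere m.+1) (t : I01 R) : isusp R m.+1 (SO m.+1) :=
  polar A (vector y) (i01 t).

Local Lemma proj_continuous : continuous (fun p => proj p.1.1 p.1.2 p.2).
Proof.
apply: polar_continuous.
- exact: (continuous_compT (@continuous_fst _ _) (@continuous_fst _ _)).
- apply: (continuous_compT _ vector_continuous).
  exact: (continuous_compT (@continuous_fst _ _) (@continuous_snd _ _)).
- by move=> p; exact/unit_neq0/vector_unit.
- exact: continuous_snd.
Qed.

Local Lemma proj0 A y y' : proj A y (clamp 0) = proj A y' (clamp 0).
Proof. by rewrite /proj clampE ?lexx ?ler01//; exact: polar0. Qed.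

Local Lemma proj1 A y : proj A y (clamp 1) = point.
Proof.
by rewrite /proj clampE ?lexx ?ler01//; exact/polar1/unit_neq0/vector_unit.
Qed.

Definition join_collapse :
    pmap (join (SO m.+1) (usphere m.+1)) (isusp R m.+1 (SO m.+1)) :=
  join_lift proj_continuous proj0 proj1.

Let rot (A : SO m.+1) (y : usphere m.+1) (t : I01 R) : sphere m.+1 :=
  polar (~~ point : bool) (value A *m vector y) (i01 t).

Local Lemma rot_vector_continuous :
  continuous (fun p : SO m.+1 * usphere m.+1 * I01 R => value p.1.1 *m vector p.1.2).
Proof.
apply: continuous_mx => i j.
rewrite (_ : (fun p => _) = fun p : SO m.+1 * usphere m.+1 * I01 R =>
   \sum_k value p.1.1 i k * vector p.1.2 k j); last first.
  by apply/funext => p; rewrite mxE.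
have cA k : continuous (fun p : SO m.+1 * usphere m.+1 * I01 R => value p.1.1 i k).
  apply: (continuous_compT _ (@coord_continuous R _ _ i k)).
  apply: (continuous_compT _ value_continuous).
  exact: (continuous_compT (@continuous_fst _ _) (@continuous_fst _ _)).
have cy k : continuous (fun p : SO m.+1 * usphere m.+1 * I01 R => vector p.1.2 k j).
  apply: (continuous_compT _ (@coord_continuous R _ _ k j)).
  apply: (continuous_compT _ vector_continuous).
  exact: (continuous_compT (@continuous_fst _ _) (@continuous_snd _ _)).
apply: (continuous_big (op := +%R)) => [|k _ p]; first exact: add_continuous.
by apply: cvgM; [exact: cA|exact: cy].
Qed.

Local Lemma rot_neq0 A y : `|value A *m vector y| != 0.
Proof.
by apply/unit_neq0/rotate_unit; [exact: value_rotations|exact: vector_unit].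
Qed.

Local Lemma rot_continuous : continuous (fun p => rot p.1.1 p.1.2 p.2).
Proof.
apply: polar_continuous.
- by move=> ?; exact: cvg_cst.
- exact: rot_vector_continuous.
- by move=> p; exact: rot_neq0.
- exact: continuous_snd.
Qed.

Local Lemma rot0 A y y' : rot A y (clamp 0) = rot A y' (clamp 0).
Proof. by rewrite /rot clampE ?lexx ?ler01//; exact: polar0. Qed.

Local Lemma rot1 A y : rot A y (clamp 1) = point.
Proof. by rewrite /rot clampE ?lexx ?ler01//; exact/polar1/rot_neq0. Qed.

Definition hopf_construction :
    pmap (join (SO m.+1) (usphere m.+1)) (sphere m.+1) :=
  join_lift rot_continuous rot0 rot1.

Definition hopf_class : hclass R (isusp R m.+1 (SO m.+1)) (sphere m.+1) :=
  xget (hzero R _ _)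
    [set g | hcomp g (hcls R join_collapse) = hcls R hopf_construction].

End hopf_construction.

Definition J (m : nat) (X : ptopologicalType) (a : hclass R X (SO m.+1)) :
    hclass R (isusp R m.+1 X) (sphere m.+1) :=
  hcomp (hopf_class m) (hsusp m.+1 a).

Lemma isuspDS m n X : isusp R m (isusp R n.+1 X) = isusp R (m + n).+1 X.
Proof. by rewrite -isuspD addnS. Qed.

End J_homomorphism.

(* Main.v *)
Require Import Defs.
From mathcomp Require Import all_boot all_order all_algebra.
From mathcomp Require Import all_classical all_reals topology normedtype.
From mathcomp Require Import ring lra.

Set Implicit Arguments.
Unset Strict Implicit.
Unset Printing Implicit Defensive.

Local Open Scope classical_set_scope.

(** The map J is given by a formula, J(a) = G o S^m a with G the class of the
    Hopf construction.  The inclusion is a property of the operation [push G],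
    a |-> G o S^p a, attached to any class G from a p-fold suspension S^p S to a
    space Z ([toda_push]).

    If an element of {alpha, S^n beta, S^n gamma}_n is (-1)^n a o S^n c, for an
    extension a of alpha and a coextension c of gamma, then G o S^p a is an
    extension of G o S^p alpha over the same mapping cone, because S^p is a
    functor and S^p S^n = S^(p+n).  The same coextension c therefore gives the
    element (-1)^(p+n) (G o S^p a) o S^(p+n) c of the second bracket, and
    multiplying it by (-1)^p leaves the sign (-1)^n of G o S^p ((-1)^n a o S^n c).

    The one point where topology enters is that S^p commutes with the sign.
    A sign reverses the outermost suspension coordinate; after S^p has been
    applied, the reversed coordinate lies p steps further inside.  So one needs
    that reversing the inner or the outer coordinate of a double suspension
    gives homotopic maps ([homotopic_susp_rev]): the reflections diag(-1, 1)
    and diag(1, -1) of the square are joined by a path of reflections.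

    Iterated suspensions such as S^p S^n X and S^(p+n) X are equal types but
    not convertible ones.  A change of type along such an equality is written
    as composition with the class [transport E] of the transported identity,
    so that functoriality and the irrelevance of equality proofs take care of
    all of them. *)

(** * Reversing the inner or the outer coordinate of a double suspension *)

Section exchange_of_reversals.
Import Order.TTheory GRing.Theory Num.Theory numFieldNormedType.Exports.
Local Open Scope ring_scope.
Context (R : realType).
Implicit Types X Y Z : ptopologicalType.

Lemma hausdorff_prod (T U : topologicalType) :
  hausdorff_space T -> hausdorff_space U -> hausdorff_space (T * U)%type.
Proof.
move=> hT hU [a b] [c d] ab; congr pair.
- apply: hT => A B nA nB.
  have [[u v] /= [Au Bu]] := ab _ _ (cvg_fst nA : nbhs (a, b) _) (cvg_fst nB : nbhs (c, d) _).
  by exists u.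
- apply: hU => A B nA nB.
  have [[u v] /= [Au Bu]] := ab _ _ (cvg_snd nA : nbhs (a, b) _) (cvg_snd nB : nbhs (c, d) _).
  by exists v.
Qed.

Section lift.
Import ArrowAsCompactOpen.
Context X Z (P : topologicalType) (F : X * I01 R -> P -> Z).

(** The product of a quotient map with a space P need not be a quotient map; it
    is one for compact Hausdorff P, since a continuous map out of a product with
    P then amounts to a continuous map into a space of functions on P.  The case needed beyond P = I is
    P = I x I, for a double suspension with a homotopy parameter. *)
Lemma susp_lift_param : compact [set: P] -> hausdorff_space P ->
  continuous (uncurry F) ->
  (forall x t s, [|| x == point, i01 t == 0 | i01 t == 1] -> F (x, t) s = point) ->
  continuous (fun zs : susp R X * P => glue_lift (c := @susp_code R X) F zs.1 zs.2).
Proof.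
move=> kP hP cF F0.
have FE p q : susp_code p = susp_code q -> F p = F q.
  move=> pq; apply/funext => s.
  by apply: (susp_codeP (f := F^~ s)) pq => x t; exact: F0.
have [_ cs] := continuous_curry cF.
rewrite (_ : (fun zs => _) = uncurry (glue_lift (c := @susp_code R X) F)); last first.
  by apply/funext => -[].
apply: continuous_uncurry => //.
- move=> s _; rewrite withinET; exists setT; first exact: filterT.
  by split; [exact: kP|exact: closedT].
- have [cc _] := continuous_curry cF.
  exact: (glue_lift_continuous (f := F : _ -> {compact-open, P -> Z})) FE.
- by apply: susp_ind => x t; rewrite glue_liftE //; exact: cs.
Qed.
End lift.

(** A point of R^2 is brought into the square I x I by the change of coordinate
    from [-1, 1] to [0, 1], followed by the retraction of the line onto [0, 1].
    With this retraction, everything outside the open square goes to a face. *)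
Definition square_coord (u : R) : I01 R := clamp ((1 + u) / 2).

Lemma square_coord_face (u : R) :
  1 <= `|u| -> (i01 (square_coord u) == 0) || (i01 (square_coord u) == 1).
Proof.
rewrite /i01 /square_coord set_valE /= ler_normr => u1.
have [u_le|u_ge] := leP u (-1).
  by rewrite (_ : Num.max _ _ = 0) ?eqxx//; apply/max_l; rewrite ge_min; apply/orP; left; lra.
apply/orP; right; apply/eqP.
have {}u1 : 1 <= u by case/orP: u1 => //; lra.
by rewrite min_r ?max_r//; lra.
Qed.

Lemma square_coord_continuous (T : topologicalType) (u : T -> R) :
  continuous u -> continuous (fun a => square_coord (u a)).
Proof.
move=> cu; apply: (continuous_compT _ (@clamp_continuous R)) => a.
by apply: cvgM; [apply: cvgD; [exact: cvg_cst|exact: cu]|exact: cvg_cst].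
Qed.

(** The matrix with rows (-a, b) and (b, a) is a reflection scaled by
    sqrt (a^2 + b^2).  Under this condition it maps no boundary point of
    [-1, 1]^2 into the open square.  For b = 0 the factor 1 suffices; in general
    the square has to grow by sqrt 2 before it can be turned. *)
Definition expanding (a b : R) := (b == 0) && (1 <= `|a|) || (2 <= a ^+ 2 + b ^+ 2).

Definition centred (t : I01 R) : R := 2 * i01 t - 1.

Lemma centred_continuous (T : topologicalType) (u : T -> I01 R) :
  continuous u -> continuous (fun a => centred (u a)).
Proof.
move=> cu a; apply: cvgB; last exact: cvg_cst.
apply: cvgM; first exact: cvg_cst.
exact: (continuous_compT cu (@i01_continuous R)).
Qed.

(** A reflection scaled by r multiplies x^2 + y^2 by r^2.  A boundary point has
    x^2 + y^2 >= 1, so for r^2 >= 2 the squares of the coordinates of its image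
    have a sum of at least 2, and one of them is at least 1. *)
Lemma expanding_boundary a b (x y : R) : expanding a b ->
  (1 <= `|x|) || (1 <= `|y|) ->
  (1 <= `|- a * x + b * y|) || (1 <= `|b * x + a * y|).
Proof.
have sq (z : R) : (1 <= `|z|) = (1 <= z ^+ 2).
  by rewrite -real_normK ?num_real// expr_ge1.
rewrite !sq => /orP[/andP[/eqP -> ]|ab].
  rewrite sq !mul0r addr0 add0r !exprMn sqrrN => a1.
  by case/orP => h; apply/orP; [left|right]; rewrite mulr_ege1.
move=> xy; have {}xy : 1 <= x ^+ 2 + y ^+ 2.
  by have := sqr_ge0 x; have := sqr_ge0 y; case/orP: xy; lra.
have E : (- a * x + b * y) ^+ 2 + (b * x + a * y) ^+ 2 =
    (a ^+ 2 + b ^+ 2) * (x ^+ 2 + y ^+ 2) by ring.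
have := ler_pM (ler0n _ 2) (ler01 : 0 <= 1 :> R) ab xy.
rewrite -E mulr1 => E2; have [//|u1] := leP 1 ((- a * x + b * y) ^+ 2).
by rewrite /=; lra.
Qed.

Lemma centred_face t : (i01 t == 0) || (i01 t == 1) -> 1 <= `|centred t|.
Proof.
rewrite /centred => /orP[/eqP ->|/eqP ->]; rewrite ler_normr; apply/orP; [right|left]; lra.
Qed.

Section family.
Context (X : ptopologicalType) (a b : I01 R -> R).
Context (ca : continuous a) (cb : continuous b) (hab : forall r, expanding (a r) (b r)).

(** The action on the two suspension coordinates of a path of scaled
    reflections, with r the parameter of the path. *)
Definition twist (x : X) (s t : I01 R) (r : I01 R) : susp R (susp R X) :=
  susp_pi (susp_pi x (square_coord (- a r * centred s + b r * centred t)))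
    (square_coord (b r * centred s + a r * centred t)).

Lemma twist_point x s t r :
  [|| x == point, (i01 s == 0) || (i01 s == 1) | (i01 t == 0) || (i01 t == 1)] ->
  twist x s t r = point.
Proof.
move=> /orP[/eqP ->|st].
  by apply: susp_pi_point; rewrite susp_pi_point ?eqxx.
have : (1 <= `|centred s|) || (1 <= `|centred t|).
  by case/orP: st => /centred_face ->; rewrite ?orbT.
case/(expanding_boundary (hab r))/orP => /square_coord_face p01; apply: susp_pi_point.
- by rewrite susp_pi_point ?eqxx// p01 orbT.
- by rewrite p01 orbT.
Qed.

Let inner (p : X * I01 R) (q : I01 R * I01 R) := twist p.1 p.2 q.1 q.2.

Lemma twist_continuous : continuous (uncurry inner).
Proof.
rewrite (_ : uncurry inner = fun pq : (X * I01 R) * (I01 R * I01 R) =>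
   twist pq.1.1 pq.1.2 pq.2.1 pq.2.2); last by apply/funext => -[].
have cx : continuous (fun pq : (X * I01 R) * (I01 R * I01 R) => pq.1.1).
  exact: (continuous_compT (@continuous_fst _ _) (@continuous_fst _ _)).
have cs : continuous (fun pq : (X * I01 R) * (I01 R * I01 R) => centred pq.1.2).
  apply: centred_continuous.
  exact: (continuous_compT (@continuous_fst _ _) (@continuous_snd _ _)).
have ct : continuous (fun pq : (X * I01 R) * (I01 R * I01 R) => centred pq.2.1).
  apply: centred_continuous.
  exact: (continuous_compT (@continuous_snd _ _) (@continuous_fst _ _)).
have cr : continuous (fun pq : (X * I01 R) * (I01 R * I01 R) => pq.2.2).
  exact: (continuous_compT (@continuous_snd _ _) (@continuous_snd _ _)).
have car := continuous_compT cr ca; have cbr := continuous_compT cr cb.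
apply: susp_pi_continuous; first apply: susp_pi_continuous => //.
- apply: square_coord_continuous => pq.
  by apply: cvgD; apply: cvgM; [apply: cvgN; exact: car|exact: cs|exact: cbr|exact: ct].
- apply: square_coord_continuous => pq.
  by apply: cvgD; apply: cvgM; [exact: cbr|exact: cs|exact: car|exact: ct].
Qed.

(** The two suspensions are quotients taken one after the other, so the map has
    to descend twice; at the first step the outer coordinate t and the parameter
    r are carried along as one parameter in I x I. *)
Definition double_lift (z : susp R (susp R X)) (r : I01 R) : susp R (susp R X) :=
  glue_lift (c := @susp_code R (susp R X))
    (fun p r => glue_lift (c := @susp_code R X) inner p.1 (p.2, r)) z r.

Lemma inner_point x s q : [|| x == point, i01 s == 0 | i01 s == 1] ->
  inner (x, s) q = point.
Proof. by move=> h; apply: twist_point; rewrite orbA h. Qed.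

Lemma inner_liftE x s q :
  glue_lift (c := @susp_code R X) inner (susp_pi x s) q = inner (x, s) q.
Proof.
rewrite glue_liftE // => u v uv; apply/funext => w.
by apply: (susp_codeP (f := inner^~ w)) uv => ? ? ?; exact: inner_point.
Qed.

Lemma outer_point (z : susp R X) (t r : I01 R) : [|| z == point, i01 t == 0 | i01 t == 1] ->
  glue_lift (c := @susp_code R X) inner z (t, r) = point.
Proof.
case/orP => [/eqP ->|].
  by rewrite -(@susp_pi_point R X point (clamp 0)) ?eqxx// inner_liftE inner_point ?eqxx.
move: z; apply: susp_ind => x s h; rewrite inner_liftE.
by apply: twist_point; rewrite /= h !orbT.
Qed.

Lemma double_liftE x s t r : double_lift (susp_pi (susp_pi x s) t) r = twist x s t r.
Proof.
rewrite /double_lift glue_liftE ?inner_liftE // => u v uv; apply/funext => w.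
have h z t' := @outer_point z t' w.
exact: (@susp_codeP R (susp R X) (susp R (susp R X)) (fun p =>
  glue_lift (c := @susp_code R X) inner p.1 (p.2, w)) h u v uv).
Qed.

Lemma double_lift_continuous :
  continuous (fun zr : susp R (susp R X) * I01 R => double_lift zr.1 zr.2).
Proof.
apply: susp_lift_param; [exact: I01_compact|exact: I01_hausdorff| |]; last first.
  by move=> z t' r h; exact: outer_point.
pose F (p : susp R X * (I01 R * I01 R)) := glue_lift (c := @susp_code R X) inner p.1 p.2.
rewrite (_ : uncurry _ = fun p : (susp R X * I01 R) * I01 R => F (p.1.1, (p.1.2, p.2))); last first.
  by apply/funext => -[].
apply: (@continuous_compT _ _ _ (fun p : (susp R X * I01 R) * I01 R => (p.1.1, (p.1.2, p.2)))).
  apply: continuous_pair.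
    exact: (continuous_compT (@continuous_fst _ _) (@continuous_fst _ _)).
  apply: continuous_pair; last exact: continuous_snd.
  exact: (continuous_compT (@continuous_fst _ _) (@continuous_snd _ _)).
apply: susp_lift_param.
- by rewrite -setXTT; apply: compact_setX; exact: I01_compact.
- by apply: hausdorff_prod; exact: I01_hausdorff.
- exact: twist_continuous.
- by move=> x s q h; exact: inner_point.
Qed.

Lemma twist_homotopic (f g : Defs.pmap (susp R (susp R X)) (susp R (susp R X))) :
  (forall x s t, f (susp_pi (susp_pi x s) t) = twist x s t (clamp 0)) ->
  (forall x s t, g (susp_pi (susp_pi x s) t) = twist x s t (clamp 1)) ->
  homotopic R f g.
Proof.
move=> fE gE; exists (fun zr => double_lift zr.1 zr.2); split=> [|z|z|r] /=.
- exact: double_lift_continuous.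
- move: z; apply: susp_ind => z t; move: z; apply: susp_ind => x s.
  by rewrite double_liftE fE.
- move: z; apply: susp_ind => z t; move: z; apply: susp_ind => x s.
  by rewrite double_liftE gE.
- rewrite -(@susp_pi_point R (susp R X) point (clamp 0)) ?eqxx//.
  rewrite -(@susp_pi_point R X point (clamp 0)) ?eqxx// double_liftE.
  by apply: twist_point; rewrite eqxx.
Qed.

End family.

Section linear_twist.
Context (X : ptopologicalType) (a b : R).
Context (hab : expanding a b).

Definition linear_twist_fun (z : susp R (susp R X)) :=
  double_lift (fun=> a) (fun=> b) z (clamp 0).

Lemma linear_twist_continuous : continuous linear_twist_fun.
Proof.
apply: (@continuous_compT _ _ _ (fun z => (z, clamp 0 : I01 R))
  (fun zr => double_lift (fun=> a) (fun=> b) zr.1 zr.2)).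
  apply: continuous_pair => z; first exact: cvg_id.
 exact: (@cvg_cst _ _ _ (nbhs z)).
have ccst (u : R) : continuous ((fun=> u) : I01 R -> R) by move=> z; exact: (@cvg_cst _ _ _ (nbhs z)).
exact: (double_lift_continuous (ccst a) (ccst b)).
Qed.

Lemma linear_twistE x s t : linear_twist_fun (susp_pi (susp_pi x s) t) =
  susp_pi (susp_pi x (square_coord (- a * centred s + b * centred t)))
    (square_coord (b * centred s + a * centred t)).
Proof. by rewrite /linear_twist_fun double_liftE. Qed.

Lemma linear_twist_point : linear_twist_fun point = point.
Proof.
rewrite -(@susp_pi_point R (susp R X) point (clamp 0)) ?eqxx//.
rewrite -(@susp_pi_point R X point (clamp 0)) ?eqxx// /linear_twist_fun double_liftE //.
by apply: twist_point => //; rewrite eqxx.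
Qed.

Definition linear_twist : Defs.pmap (susp R (susp R X)) (susp R (susp R X)) :=
  Pmap linear_twist_continuous linear_twist_point.

End linear_twist.

Lemma linear_twist_segment X (a b a' b' : R) (h : expanding a b) (h' : expanding a' b') :
  (forall r : R, 0 <= r <= 1 ->
    expanding ((1 - r) * a + r * a') ((1 - r) * b + r * b')) ->
  homotopic R (linear_twist X h) (linear_twist X h').
Proof.
move=> hs.
have cseg (u v : R) : continuous (fun r : I01 R => (1 - i01 r) * u + i01 r * v).
  move=> r; have ci := @i01_continuous R r.
  have cu (w : R) : {for r, continuous ((fun=> w) : I01 R -> R)}.
    exact: (@cvg_cst _ _ _ (nbhs r)).
  exact: (cvgD (cvgM (cvgB (cu 1) ci) (cu u)) (cvgM ci (cu v))).
apply: (twist_homotopic (cseg a a') (cseg b b')).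
- by move=> r; exact: hs (i01_itv r).
- move=> x s t; rewrite [LHS]linear_twistE // /twist clampE ?lexx ?ler01//.
  by rewrite !subr0 !mul1r !mul0r !addr0.
- move=> x s t; rewrite [LHS]linear_twistE // /twist clampE ?lexx ?ler01//.
  by rewrite !subrr !mul1r !mul0r !add0r.
Qed.

Lemma square_coord_centred t : square_coord (centred t) = t.
Proof.
rewrite /square_coord /centred (_ : (1 + (2 * i01 t - 1)) / 2 = i01 t) ?i01K//.
by field.
Qed.

Lemma square_coordN_centred t : square_coord (- centred t) = clamp (1 - i01 t).
Proof. by rewrite /square_coord /centred; congr clamp; field. Qed.

Lemma expanding_axis (a : R) : 1 <= `|a| -> expanding a 0.
Proof. by rewrite /expanding eqxx => ->. Qed.

(** The path of reflections runs along (a, b) = (1, 0), (2, 0), (0, 2), (-2, 0),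
    (-1, 0): the square is first enlarged, then turned over with
    a^2 + b^2 >= 2 throughout, then shrunk again. *)
Lemma homotopic_susp_rev X :
  homotopic R (susp_map R (susp_rev R X)) (susp_rev R (susp R X)).
Proof.
have e1 : expanding 1 0 by apply: expanding_axis; rewrite normr1.
have e2 : expanding 2 0 by apply: expanding_axis; rewrite ler_normr ler1n.
have e02 : expanding 0 2 by rewrite /expanding; apply/orP; right; lra.
have en2 : expanding (- 2) 0 by apply: expanding_axis; rewrite normrN ler_normr ler1n.
have en1 : expanding (- 1) 0 by apply: expanding_axis; rewrite normrN1.
(* The end points of the path are exactly the two reversals. *)
have -> : susp_map R (susp_rev R X) = linear_twist X e1.
  apply: pmap_eqP; apply: susp_ind => z t; move: z; apply: susp_ind => x s.
  rewrite [RHS]linear_twistE // susp_mapE susp_revE mulN1r !mul0r addr0 add0r mul1r.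
  by rewrite square_coord_centred square_coordN_centred.
have -> : susp_rev R (susp R X) = linear_twist X en1.
  apply: pmap_eqP; apply: susp_ind => z t; move: z; apply: susp_ind => x s.
  rewrite [RHS]linear_twistE // susp_revE opprK mul1r !mul0r addr0 add0r mulN1r.
  by rewrite square_coord_centred square_coordN_centred.
apply: (homotopic_trans (g := linear_twist X e2)).
  apply: linear_twist_segment => r /andP[r0 r1]; rewrite !mulr0 addr0.
  by apply: expanding_axis; rewrite ler_normr; apply/orP; left; lra.
apply: (homotopic_trans (g := linear_twist X e02)).
  (* On this segment a^2 + b^2 - 2 = 2 (2 r - 1)^2. *)
  apply: linear_twist_segment => r /andP[r0 r1]; apply/orP; right.
  by have := sqr_ge0 (2 * r - 1); lra.
apply: (homotopic_trans (g := linear_twist X en2)).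
  apply: linear_twist_segment => r /andP[r0 r1]; apply/orP; right.
  by have := sqr_ge0 (2 * r - 1); lra.
apply: linear_twist_segment => r /andP[r0 r1]; rewrite !mulr0 addr0.
by apply: expanding_axis; rewrite ler_normr; apply/orP; right; lra.
Qed.

End exchange_of_reversals.

(** * Suspension as a functor on homotopy classes *)

Section homotopy_category.
Import Order.TTheory GRing.Theory Num.Theory.
Context (R : realType).
Implicit Types W X Y Z : ptopologicalType.

Local Notation "b \oh a" := (hcomp b a) (at level 50, left associativity).

Lemma hcompA W X Y Z (c : hclass R Y Z) (b : hclass R X Y) (a : hclass R W X) :
  c \oh (b \oh a) = c \oh b \oh a.
Proof.
rewrite -[a]hcls_repr -[b]hcls_repr -[c]hcls_repr !hcompE.
by congr hcls; exact: pmap_eqP.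
Qed.

Lemma hcomp1r X Y (a : hclass R X Y) : a \oh hcls R (pid X) = a.
Proof.
by rewrite -[a]hcls_repr hcompE; congr hcls; exact: pmap_eqP.
Qed.

Lemma hcomp1l X Y (a : hclass R X Y) : hcls R (pid Y) \oh a = a.
Proof.
by rewrite -[a]hcls_repr hcompE; congr hcls; exact: pmap_eqP.
Qed.

Lemma hcomp0r X Y Z (b : hclass R Y Z) : b \oh hzero R X Y = hzero R X Z.
Proof.
rewrite -[b]hcls_repr /hzero hcompE; congr hcls; apply: pmap_eqP => x.
exact: pmap_point.
Qed.

Lemma hcomp0l X Y Z (a : hclass R X Y) : hzero R Y Z \oh a = hzero R X Z.
Proof.
by rewrite -[a]hcls_repr /hzero hcompE; congr hcls; exact: pmap_eqP.
Qed.

Lemma susp_map_const X Y : susp_map R (pconst X Y) = pconst (susp R X) (susp R Y).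
Proof.
apply: pmap_eqP; apply: susp_ind => x t; rewrite susp_mapE.
by apply: susp_pi_point; rewrite eqxx.
Qed.

Lemma hsusp_comp n X Y Z (b : hclass R Y Z) (a : hclass R X Y) :
  hsusp n (b \oh a) = hsusp n b \oh hsusp n a.
Proof.
rewrite -[a]hcls_repr -[b]hcls_repr hcompE !hsuspE hcompE; congr hcls.
by elim: n => //= n ->; exact: susp_map_comp.
Qed.

Lemma hsusp_id n X : hsusp n (hcls R (pid X)) = hcls R (pid (isusp R n X)).
Proof.
by rewrite hsuspE; congr hcls; elim: n => //= n ->; exact: susp_map_id.
Qed.

Lemma hsusp0 n X Y : hsusp n (hzero R X Y) = hzero R (isusp R n X) (isusp R n Y).
Proof.
by rewrite hsuspE; congr hcls; elim: n => //= n ->; exact: susp_map_const.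
Qed.

Lemma hsuspS n X Y (a : hclass R X Y) : hsusp n.+1 a = hsusp 1 (hsusp n a).
Proof. by rewrite -[a]hcls_repr !hsuspE. Qed.

Definition transport X X' (E : X = X') : hclass R X X' :=
  hcls R (eq_rect X (Defs.pmap X) (pid X) X' E).

Lemma transport_id X (E : X = X) : transport E = hcls R (pid X).
Proof. by rewrite (Prop_irrelevance E erefl). Qed.

Lemma transport_trans X X' X'' (E : X = X') (F : X' = X'') :
  transport F \oh transport E = transport (etrans E F).
Proof. by case: _ / F; rewrite /= transport_id hcomp1l. Qed.

Lemma hsusp_transport n X X' (E : X = X') :
  hsusp n (transport E) = transport (congr1 (isusp R n) E).
Proof. by case: _ / E; rewrite !transport_id hsusp_id. Qed.

Lemma hcastE X X' Y (E : X = X') (a : hclass R X Y) :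
  hcast E a = a \oh transport (esym E).
Proof. by case: _ / E; rewrite transport_id hcomp1r. Qed.

(** In the step, the equality for m + 1 is the suspension of the equality for m:
    two proofs of an equality of spaces are equal. *)
Lemma hsuspD m n X Y (a : hclass R X Y) :
  transport (isuspD R m n Y) \oh hsusp (m + n) a =
  hsusp m (hsusp n a) \oh transport (isuspD R m n X).
Proof.
elim: m => [|m IH].
  rewrite (transport_id (isuspD R 0 n Y)) (transport_id (isuspD R 0 n X)).
  by rewrite hcomp1l hcomp1r -[a]hcls_repr !hsuspE.
have congrD U : transport (isuspD R m.+1 n U) = hsusp 1 (transport (isuspD R m n U)).
  by rewrite hsusp_transport; congr transport; exact: Prop_irrelevance.
rewrite !congrD (hsuspS m) (hsuspS (m + n)).
transitivity (hsusp 1 (transport (isuspD R m n Y) \oh hsusp (m + n) a)).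
  exact: (esym (hsusp_comp 1 _ _)).
by rewrite IH; exact: (hsusp_comp 1).
Qed.

Definition hrev X : hclass R (susp R X) (susp R X) := hcls R (susp_rev R X).

Lemma hrevK X : hrev X \oh hrev X = hcls R (pid (susp R X)).
Proof.
rewrite /hrev hcompE; congr hcls; apply: pmap_eqP; apply: susp_ind => x t.
rewrite [LHS](_ : _ = susp_rev R X (susp_rev R X (susp_pi x t))) // !susp_revE.
rewrite clampE ?subKr ?i01K//.
by have /andP[t0 t1] := i01_itv t; rewrite subr_ge0 t1 gerBl.
Qed.

Lemma hrev_natural X Y (a : hclass R X Y) :
  hrev Y \oh hsusp 1 a = hsusp 1 a \oh hrev X.
Proof.
rewrite -[a]hcls_repr hsuspE /hrev !hcompE; congr hcls; apply: pmap_eqP.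
apply: susp_ind => x t.
rewrite [LHS](_ : _ = susp_rev R Y (susp_map R (repr a) (susp_pi x t))) //.
rewrite [RHS](_ : _ = susp_map R (repr a) (susp_rev R X (susp_pi x t))) //.
by rewrite !(susp_mapE, susp_revE).
Qed.

Lemma hsignD k l n X Y (a : hclass R (isusp R n.+1 X) Y) :
  hsign (k + l) a = hsign k (hsign l a).
Proof. exact: iterD. Qed.

Lemma hnegK n X Y : involutive (@hneg R n X Y).
Proof. by move=> a; rewrite /hneg -hcompA hrevK hcomp1r. Qed.

Lemma hsignK k n X Y : involutive (@hsign R k n X Y).
Proof.
move=> a; elim: k => // k IH.
by rewrite /hsign iterSr [X in hneg X]iterS hnegK; exact: IH.
Qed.

Lemma hsusp_hrev X : hsusp 1 (hrev X) = hrev (susp R X).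
Proof.
rewrite /hrev hsuspE; apply/hclsP; exact: homotopic_susp_rev.
Qed.

(** Moving the reversed coordinate outwards past m suspensions, one exchange of
    neighbouring coordinates at a time. *)
Lemma hsusp_rev m X :
  transport (esym (isuspS R m X)) \oh hsusp m (hrev X) =
  hrev (isusp R m X) \oh transport (esym (isuspS R m X)).
Proof.
elim: m => [|m IH].
  rewrite (transport_id (esym (isuspS R 0 X))).
  by rewrite hcomp1l hcomp1r -[LHS]hcls_repr hsuspE hcls_repr.
have -> : transport (esym (isuspS R m.+1 X)) =
    hsusp 1 (transport (esym (isuspS R m X))).
  by rewrite hsusp_transport; congr transport; exact: Prop_irrelevance.
rewrite (hsuspS m) -(hsusp_hrev (isusp R m X)).
transitivity (hsusp 1 (transport (esym (isuspS R m X)) \oh hsusp m (hrev X))).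
  exact: (esym (hsusp_comp 1 _ _)).
by rewrite IH; exact: (hsusp_comp 1).
Qed.

(** * Toda brackets under suspension followed by a fixed class *)

Section pushforward.
Context (p n : nat) (S Z : ptopologicalType) (G : hclass R (isusp R p S) Z).

Definition push X (a : hclass R X S) : hclass R (isusp R p X) Z := G \oh hsusp p a.

Lemma push_comp X Y (a : hclass R (isusp R n Y) S) (b : hclass R X Y) :
  hcast (esym (isuspD R p n Y)) (push a) \oh hsusp (p + n) b =
  hcast (esym (isuspD R p n X)) (push (a \oh hsusp n b)).
Proof.
rewrite !hcastE /push hsusp_comp -hcompA !esymK hsuspD.
by rewrite !hcompA.
Qed.

(** Reversal of the last coordinate of S^(n+1) W becomes, after S^p, reversal of
    the coordinate in position n + 1 of n + 1 + p, and this is homotopic to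
    reversal of the outermost one. *)
Lemma push_neg W (a : hclass R (isusp R n.+1 W) S) :
  hcast (isuspDS R p n W) (push (hneg a)) = hneg (hcast (isuspDS R p n W) (push a)).
Proof.
pose V := isusp R n W.
have DS : transport (esym (isuspDS R p n W)) =
    transport (isuspS R p V) \oh hsusp 1 (transport (isuspD R p n W)).
  rewrite hsusp_transport [RHS]transport_trans.
  by congr transport; exact: Prop_irrelevance.
have revE : hsusp p (hrev V) \oh transport (isuspS R p V) =
    transport (isuspS R p V) \oh hrev (isusp R p V).
  transitivity (transport (isuspS R p V) \oh
      (transport (esym (isuspS R p V)) \oh hsusp p (hrev V)) \oh
      transport (isuspS R p V)).
    by rewrite !hcompA transport_trans transport_id hcomp1l.
  rewrite hsusp_rev -!hcompA transport_trans transport_id.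
  by rewrite hcomp1r.
have key : hsusp p (hrev V) \oh transport (esym (isuspDS R p n W)) =
    transport (esym (isuspDS R p n W)) \oh hrev (isusp R (p + n) W).
  by rewrite DS hcompA revE -!hcompA hrev_natural.
rewrite /hneg !hcastE /push hsusp_comp -!hcompA.
congr (G \oh (hsusp p a \oh _)); exact: key.
Qed.

Lemma push_sign k W (a : hclass R (isusp R n.+1 W) S) :
  hcast (isuspDS R p n W) (push (hsign k a)) =
  hsign k (hcast (isuspDS R p n W) (push a)).
Proof. by elim: k => //= k IH; rewrite push_neg IH. Qed.

(** Both brackets can be computed with the same mapping cone and the same
    coextension.  The sign (-1)^p is the difference between the sign (-1)^n in
    the definition of the first bracket and (-1)^(p+n) in that of the second. *)
Lemma toda_push W X Y (alpha : hclass R (isusp R n Y) S) (beta : hclass R X Y)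
    (gamma : hclass R W X) theta :
  toda alpha beta gamma theta ->
  exists2 theta', toda (hcast (esym (isuspD R p n Y)) (push alpha)) beta gamma theta' &
    hsign p theta' = hcast (isuspDS R p n W) (push theta).
Proof.
move=> [b [a [c [hb ha hc ->]]]].
pose a' := hcast (esym (isuspD R p n (mcone R b))) (push a).
exists (hsign (p + n) (hcast (esym (isuspS R (p + n) W)) (a' \oh hsusp (p + n) c))).
  by exists b, a', c; split=> //; rewrite /is_extension push_comp ha.
rewrite hsignD hsignK push_sign push_comp; congr hsign.
rewrite !hcastE /push !hsusp_comp hsusp_transport !esymK -!hcompA !transport_trans.
by congr (G \oh (hsusp p a \oh (_ \oh transport _))); exact: Prop_irrelevance.
Qed.

Lemma toda_defined_push W X Y (alpha : hclass R (isusp R n Y) S)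
    (beta : hclass R X Y) (gamma : hclass R W X) :
  toda_defined alpha beta gamma ->
  toda_defined (hcast (esym (isuspD R p n Y)) (push alpha)) beta gamma.
Proof.
move=> [ab bg]; split=> //.
by rewrite push_comp ab /push hsusp0 hcomp0r hcastE hcomp0l.
Qed.

End pushforward.
End homotopy_category.

Theorem theorem3p1 (R : realType) (m n h k l : nat)
    (alpha : pi_ R (h + n) (SO R m.+1))
    (beta : pi_ R k (sphere R h)) (gamma : pi_ R l (sphere R k)) :
  let alpha' : hclass R (isusp R n (sphere R h)) (SO R m.+1) :=
    hcast (sphereD R h n) alpha in
  let Jalpha : hclass R (isusp R (m.+1 + n) (sphere R h)) (sphere R m.+1) :=
    hcast (esym (isuspD R m.+1 n (sphere R h))) (J alpha') in
  hcomp alpha' (hsusp n beta) = hzero R _ _ ->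
  hcomp beta gamma = hzero R _ _ ->
  toda_defined Jalpha beta gamma /\
  (fun theta => hcast (isuspDS R m.+1 n (sphere R l)) (J theta))
      @` toda alpha' beta gamma
    `<=` (fun theta => hsign m.+1 theta) @` toda Jalpha beta gamma.
Proof.
move=> alpha' Jalpha ab bg; split; first exact: toda_defined_push.
move=> _ [theta /(toda_push (hopf_class R m)) [theta' htheta' <-] <-].
by exists theta'.
Qed.
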